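(* Let $B,\bar B$ be real or complex vector spaces and $L(\varepsilon)=\sum_{i=0}^\infty\varepsilon^iL_i$ a formal power series with $L_i\in L(B,\bar B)$, $L(\varepsilon)\not\equiv0$. Run the recursion of the context with some choice of complements. For $i\ge1$ let $B_i:=\bar S_iS_i^{-1}\mathcal P_i\in L(\bar B,\bar B)$, and for $k\ge1$ define $e_{i,k+1}\in L(\bar B,B)$, $i=1,\dots,k$, by $$e_{k,k+1}:=-S_k^{-1}\mathcal P_k,\qquad e_{i,k+1}:=-S_i^{-1}\mathcal P_i(I_{\bar B}-B_{i+1})\cdots(I_{\bar B}-B_k)\quad(1\le i\le k-1).$$ Then for every $k\ge1$ $$(\bar S_1\ \cdots\ \bar S_k)\cdot\begin{pmatrix} e_{1,k+1} \\ \vdots \\ e_{k,k+1} \end{pmatrix}=\sum_{i=1}^k\bar S_ie_{i,k+1}=-(\mathcal P_1+\cdots+\mathcal P_k).$$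
   Context: $L(X,Y)$ denotes the linear maps from $X$ to $Y$; $I_X$ is the identity. Recursion. Put $N_0:=B$, $N_0^c:=\{0\}$, $R_0:=\{0\}$, $R_0^c:=\bar B$, $\bar S_1:=S_1:=L_0$, $E_{1,1}:=M_{1,1}:=I_B$. At each stage $j\ge1$, given $S_j\in L(B,R_{j-1}^c)$, set $N_j:=\{n\in N_{j-1}\mid S_jn=0\}$, $R_j:=S_j(N_{j-1})$ and choose algebraic direct complements $N_{j-1}=N_j^c\oplus N_j$, $R_{j-1}^c=R_j\oplus R_j^c$. Then $B=N_1^c\oplus\cdots\oplus N_j^c\oplus N_j$ and $\bar B=R_1\oplus\cdots\oplus R_j\oplus R_j^c$; $\mathcal P_j$ denotes the projection of $\bar B$ onto $R_j$ defined by the latter decomposition (regarded also as a map into $\bar B$), and $S_j^{-1}:R_j\to N_j^c$ denotes the inverse of the bijection $S_j|_{N_j^c}:N_j^c\to R_j$. At stage $j\ge2$, the operators are defined by $$\bar S_j:=\sum_{i=1}^{j-1}L_iM_{i,j-1},\qquad S_j:=(I_{\bar B}-\mathcal P_1-\cdots-\mathcal P_{j-1})\bar S_j,$$ $$E_{j,j}:=I_B,\qquad E_{i,j}:=-S_i^{-1}\mathcal P_i\sum_{\nu=i+1}^{j}\bar S_\nu E_{\nu,j}\quad (i=j-1,\dots,1),$$ $$M_{1,j}:=E_{1,j},\qquad M_{i,j}:=\sum_{\nu=i}^{j}M_{i-1,\nu-1}E_{\nu,j}\quad(i=2,\dots,j).$$ *)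

(* Defs.v *)
(* MathComp / MathComp-Analysis *)
From HB Require Import structures.
From mathcomp Require Import all_boot all_order all_algebra.
From mathcomp Require Import boolp classical_sets functions reals.
From mathcomp Require Import complex.
Set Implicit Arguments.
Unset Strict Implicit.
Unset Printing Implicit Defensive.
Import Order.TTheory GRing.Theory Num.Theory.
Local Open Scope classical_set_scope.
Local Open Scope ring_scope.

Variant ground := RealScalars | ComplexScalars.

Definition scalars (R : realType) (g : ground) : fieldType :=
  match g with RealScalars => R | ComplexScalars => R[i] end.

Definition subspace (K : fieldType) (V : lmodType K) (A : set V) : Prop :=
  A 0 /\ forall (a : K) (u v : V), A u -> A v -> A (a *: u + v).

Definition direct_sum (K : fieldType) (V : lmodType K) (A A1 A2 : set V) : Prop :=
  [/\ subspace A1, subspace A2,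
      A = [set x + y | x in A1 & y in A2] & A1 `&` A2 = [set 0]].

(* Operators are plain functions, added pointwise; the recursion itself makes
   them linear.  Stages are numbered from 1, subspaces from 0; the values of
   the fields at indices not constrained by [is_recursion] are irrelevant. *)
Record stages (K : fieldType) (B Bb : lmodType K) := Stages {
  spN : nat -> set B;
  spNc : nat -> set B;
  spR : nat -> set Bb;
  spRc : nat -> set Bb;
  opS : nat -> B -> Bb;
  opSbar : nat -> B -> Bb;
  opE : nat -> nat -> B -> B;
  opM : nat -> nat -> B -> B
}.

(* The [R_j]-component in Bb = R_1 (+) ... (+) R_j (+) Rc_j. *)
Definition proj (K : fieldType) (B Bb : lmodType K) (d : stages B Bb)
    (j : nat) (y : Bb) : Bb :=
  xget 0 [set r | exists (x : nat -> Bb) (c : Bb),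
    [/\ forall i, (1 <= i <= j)%N -> spR d i (x i), spRc d j c,
        y = \sum_(1 <= i < j.+1) x i + c & r = x j]].

(* The inverse of S_j : Nc_j -> R_j, extended by 0 outside R_j; it is only
   ever applied after [proj d j]. *)
Definition Sinv (K : fieldType) (B Bb : lmodType K) (d : stages B Bb)
    (j : nat) : Bb -> B :=
  'pinv_(fun=> 0) (spNc d j) (opS d j).

Record is_recursion (K : fieldType) (B Bb : lmodType K)
    (L : nat -> {linear B -> Bb}) (d : stages B Bb) : Prop := IsRecursion {
  spN0 : spN d 0 = setT;
  spNc0 : spNc d 0 = [set 0];
  spR0 : spR d 0 = [set 0];
  spRc0 : spRc d 0 = setT;

  spNE : forall j, (1 <= j)%N ->
    spN d j = [set n | spN d j.-1 n /\ opS d j n = 0];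
  spRE : forall j, (1 <= j)%N -> spR d j = opS d j @` spN d j.-1;
  spN_split : forall j, (1 <= j)%N ->
    direct_sum (spN d j.-1) (spNc d j) (spN d j);
  spRc_split : forall j, (1 <= j)%N ->
    direct_sum (spRc d j.-1) (spR d j) (spRc d j);

  opSbar1 : opSbar d 1 = L 0%N;
  opS1 : opS d 1 = L 0%N;
  opE11 : opE d 1 1 = id;
  opM11 : opM d 1 1 = id;

  opSbarE : forall j, (2 <= j)%N ->
    opSbar d j = \sum_(1 <= i < j) (L i \o opM d i j.-1);
  opSE : forall j, (2 <= j)%N ->
    opS d j = (id - \sum_(1 <= i < j) proj d i) \o opSbar d j;
  opEjj : forall j, (2 <= j)%N -> opE d j j = id;
  opEij : forall i j, (1 <= i < j)%N ->
    opE d i j = - (Sinv d i \o proj d i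
                   \o \sum_(i.+1 <= v < j.+1) (opSbar d v \o opE d v j));
  opM1j : forall j, (2 <= j)%N -> opM d 1 j = opE d 1 j;
  opMij : forall i j, (2 <= i <= j)%N ->
    opM d i j = \sum_(i <= v < j.+1) (opM d i.-1 v.-1 \o opE d v j)
}.

Definition opB (K : fieldType) (B Bb : lmodType K) (d : stages B Bb)
    (i : nat) : Bb -> Bb :=
  opSbar d i \o Sinv d i \o proj d i.

(* [ope d i k] is e_{i,k+1} = - S_i^-1 P_i (I - B_{i+1}) ... (I - B_k); for
   i = k the product is empty, which gives e_{k,k+1} = - S_k^-1 P_k. *)
Definition ope (K : fieldType) (B Bb : lmodType K) (d : stages B Bb)
    (i k : nat) : Bb -> B :=
  - (Sinv d i \o proj d i
     \o \big[(fun f g : Bb -> Bb => f \o g)/id]_(i.+1 <= l < k.+1) (id - opB d l)).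

(* Main.v *)
(* Each S_i^-1 P_i is a right inverse of S_i on R_i, and S_k is
   (I - P_1 - ... - P_{k-1}) applied to the k-th S-bar.  Hence
   (I - P_1 - ... - P_{k-1}) B_k = P_k, and by induction on k
     (I - B_1) (I - B_2) ... (I - B_k) = I - P_1 - ... - P_k.
   The sum to be computed is the sum of the
   - B_i (I - B_{i+1}) ... (I - B_k), which telescopes to
   (I - B_1) ... (I - B_k) - I. *)
Require Import Defs.
From HB Require Import structures.
From mathcomp Require Import all_boot all_order all_algebra.
From mathcomp Require Import boolp classical_sets functions reals.
Set Implicit Arguments.
Unset Strict Implicit.
Unset Printing Implicit Defensive.
Import Order.TTheory GRing.Theory Num.Theory.
Local Open Scope ring_scope.

Lemma linear_comp_prop (K : fieldType) (U V W : lmodType K)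
    (f : V -> W) (g : U -> V) :
  linear f -> linear g -> linear (f \o g).
Proof. by move=> lf lg a u v /=; rewrite lg lf. Qed.

Lemma linear_opp_prop (K : fieldType) (U V : lmodType K) (f : U -> V) :
  linear f -> linear (- f).
Proof. by move=> lf a u v; rewrite !opprfctE lf opprD scalerN. Qed.

Lemma linear_add_prop (K : fieldType) (U V : lmodType K) (f g : U -> V) :
  linear f -> linear g -> linear (f + g).
Proof. by move=> lf lg a u v; rewrite !addrfctE lf lg scalerDr addrACA. Qed.

Lemma linear_sum_prop (K : fieldType) (U V : lmodType K) (m n : nat)
    (F : nat -> U -> V) :
  (forall i, (m <= i < n)%N -> linear (F i)) ->
  linear (\sum_(m <= i < n) F i).
Proof.
move=> lF a u v; rewrite fct_sumE scaler_sumr -big_split /=.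
by apply: eq_big_nat => i /lF ->.
Qed.

Lemma linear_prop0 (K : fieldType) (U V : lmodType K) (f : U -> V) :
  linear f -> f 0 = 0.
Proof. by move=> lf; rewrite -(addNr 0) -scaleN1r lf scaleN1r addNr. Qed.

Lemma linear_propN (K : fieldType) (U V : lmodType K) (f : U -> V) (u : U) :
  linear f -> f (- u) = - f u.
Proof.
by move=> lf; rewrite -[- u]addr0 -scaleN1r lf linear_prop0 // addr0 scaleN1r.
Qed.

Lemma linear_propD (K : fieldType) (U V : lmodType K) (f : U -> V) (u v : U) :
  linear f -> f (u + v) = f u + f v.
Proof. by move=> lf; rewrite -[u]scale1r lf !scale1r. Qed.

Lemma linear_propB (K : fieldType) (U V : lmodType K) (f : U -> V) (u v : U) :
  linear f -> f (u - v) = f u - f v.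
Proof. by move=> lf; rewrite linear_propD // linear_propN. Qed.

Lemma subspaceN (K : fieldType) (V : lmodType K) (A : set V) (u : V) :
  subspace A -> A u -> A (- u).
Proof.
by move=> [A0 AL] Au; rewrite -[- u]addr0 -scaleN1r; apply: AL.
Qed.

Lemma subspaceD (K : fieldType) (V : lmodType K) (A : set V) (u v : V) :
  subspace A -> A u -> A v -> A (u + v).
Proof. by move=> [_ AL] Au Av; rewrite -[u]scale1r; apply: AL. Qed.

Lemma direct_sum_subl (K : fieldType) (V : lmodType K) (A A1 A2 : set V)
    (u : V) :
  direct_sum A A1 A2 -> A1 u -> A u.
Proof.
move=> [_ [A20 _] -> _] A1u; exists u => //; exists 0 => //.
by rewrite addr0.
Qed.

Lemma direct_sum_eq0 (K : fieldType) (V : lmodType K) (A A1 A2 : set V)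
    (u v : V) :
  direct_sum A A1 A2 -> A1 u -> A2 v -> u + v = 0 -> u = 0 /\ v = 0.
Proof.
move=> [_ sA2 _ A12] A1u A2v /eqP; rewrite addr_eq0 => /eqP uE.
have : (A1 `&` A2)%classic u by split=> //; rewrite uE; apply: subspaceN.
rewrite A12 => /= u0; split => //.
by move/eqP: uE; rewrite u0 eq_sym oppr_eq0 => /eqP.
Qed.

Lemma subspace_Rc (K : fieldType) (B Bb : lmodType K) (L : nat -> {linear B -> Bb})
    (d : stages B Bb) (j : nat) :
  is_recursion L d -> subspace (spRc d j).
Proof.
move=> dr; case: j => [|j]; first by rewrite (spRc0 dr).
by have [] := spRc_split dr (j := j.+1) isT.
Qed.

Lemma stage_decomp (K : fieldType) (B Bb : lmodType K)
    (L : nat -> {linear B -> Bb}) (d : stages B Bb) (j : nat) (y : Bb) :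
  is_recursion L d ->
  exists (x : nat -> Bb) (c : Bb),
    [/\ forall i, (1 <= i <= j)%N -> spR d i (x i), spRc d j c
      & y = \sum_(1 <= i < j.+1) x i + c].
Proof.
move=> dr; elim: j => [|j [x [c [xR cRc ->]]]].
  exists (fun=> 0), y; split; first by case.
    by rewrite (spRc0 dr).
  by rewrite big_nil add0r.
have [_ _ RcE _] := spRc_split dr (j := j.+1) isT.
move: cRc; rewrite RcE => -[r rR [c' c'Rc <-]].
exists (fun i => if i == j.+1 then r else x i), c'; split => //.
  move=> i /andP[i1 ij]; case: eqP => [->//|/eqP iNj].
  by apply: xR; rewrite i1 -ltnS ltn_neqAle iNj.
rewrite [in RHS]big_nat_recr //= eqxx addrA; congr (_ + _ + _).
by apply: eq_big_nat => i /andP[_ ij]; rewrite ltn_eqF.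
Qed.

Lemma stage_eq0 (K : fieldType) (B Bb : lmodType K)
    (L : nat -> {linear B -> Bb}) (d : stages B Bb) (j : nat)
    (x : nat -> Bb) (c : Bb) :
  is_recursion L d ->
  (forall i, (1 <= i <= j)%N -> spR d i (x i)) -> spRc d j c ->
  \sum_(1 <= i < j.+1) x i + c = 0 ->
  forall i, (1 <= i <= j)%N -> x i = 0.
Proof.
move=> dr; elim: j c => [|j IH] c xR cRc; first by move=> _ [].
have ds := spRc_split dr (j := j.+1) isT.
have xRj : spR d j.+1 (x j.+1) by apply: xR; rewrite leqnn.
have xcRc : spRc d j (x j.+1 + c).
  by case: (ds) => _ _ /= -> _; exists (x j.+1) => //; exists c.
rewrite big_nat_recr //= -addrA => xc0.
have x0 i : (1 <= i <= j)%N -> x i = 0.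
  apply: IH xcRc xc0 i => i /andP[i1 ij]; apply: xR.
  by rewrite i1 (leqW ij).
move: xc0; rewrite big_nat big1 ?add0r; last by move=> i; apply: x0.
move=> /(direct_sum_eq0 ds xRj cRc)[xj0 _] i /andP[i1].
by rewrite leq_eqVlt ltnS => /orP[/eqP->//|ij]; rewrite x0 ?i1.
Qed.

Lemma proj_decomp (K : fieldType) (B Bb : lmodType K)
    (L : nat -> {linear B -> Bb}) (d : stages B Bb) (j : nat)
    (x : nat -> Bb) (c : Bb) :
  is_recursion L d -> (1 <= j)%N ->
  (forall i, (1 <= i <= j)%N -> spR d i (x i)) -> spRc d j c ->
  proj d j (\sum_(1 <= i < j.+1) x i + c) = x j.
Proof.
move=> dr j1 xR cRc; apply: xget_unique; first by exists x, c.
move=> _ [x' [c' [x'R c'Rc xE ->]]].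
apply/eqP; rewrite -subr_eq0; apply/eqP.
apply: (@stage_eq0 _ _ _ _ _ j (fun i => x' i - x i) (c' - c) dr);
  last by rewrite j1 leqnn.
- move=> i ij; have [i1 _] := andP ij.
  have [sR _ _ _] := spRc_split dr i1.
  by apply: subspaceD (x'R _ ij) _ => //; apply: subspaceN (xR _ ij).
- have sRc := subspace_Rc j dr.
  by apply: subspaceD => //; apply: subspaceN.
- by rewrite sumrB addrACA -opprD -xE subrr.
Qed.

Lemma proj_in (K : fieldType) (B Bb : lmodType K)
    (L : nat -> {linear B -> Bb}) (d : stages B Bb) (j : nat) (y : Bb) :
  is_recursion L d -> (1 <= j)%N -> spR d j (proj d j y).
Proof.
move=> dr j1; have [x [c [xR cRc ->]]] := stage_decomp j y dr.
by rewrite (proj_decomp dr) //; apply: xR; rewrite j1 leqnn.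
Qed.

Lemma proj_linear (K : fieldType) (B Bb : lmodType K)
    (L : nat -> {linear B -> Bb}) (d : stages B Bb) (j : nat) :
  is_recursion L d -> (1 <= j)%N -> linear (proj d j).
Proof.
move=> dr j1 a u v.
have [x [c [xR cRc ->]]] := stage_decomp j u dr.
have [x' [c' [x'R c'Rc ->]]] := stage_decomp j v dr.
rewrite !(proj_decomp dr) // scalerDr addrACA scaler_sumr -big_split /=.
rewrite (proj_decomp (x := fun i => a *: x i + x' i) dr) //.
- move=> i ij; have [i1 _] := andP ij.
  have [[_ RL] _ _ _] := spRc_split dr i1.
  by apply: RL; [apply: xR|apply: x'R].
- by have [_] := subspace_Rc j dr; apply.
Qed.

Lemma id_sub_proj_linear (K : fieldType) (B Bb : lmodType K)
    (L : nat -> {linear B -> Bb}) (d : stages B Bb) (j : nat) :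
  is_recursion L d -> linear (id - \sum_(1 <= i < j) proj d i).
Proof.
move=> dr; apply: linear_add_prop => //; apply: linear_opp_prop.
by apply: linear_sum_prop => i /andP[i1 _]; apply: proj_linear dr i1.
Qed.

Lemma Sinv_image (K : fieldType) (B Bb : lmodType K)
    (L : nat -> {linear B -> Bb}) (d : stages B Bb) (j : nat) (r : Bb) :
  is_recursion L d -> (1 <= j)%N -> linear (opS d j) -> spR d j r ->
  spNc d j (Sinv d j r) /\ opS d j (Sinv d j r) = r.
Proof.
move=> dr j1 lS Rr.
have rI : (opS d j @` spNc d j)%classic r.
  move: Rr; rewrite (spRE dr j1) => -[n nN <-].
  have [_ _ NE _] := spN_split dr j1.
  move: nN; rewrite NE => -[n1 n1Nc [n2 n2N <-]].
  move: n2N; rewrite (spNE dr j1) => -[_ Sn2].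
  by exists n1 => //; rewrite linear_propD // Sn2 addr0.
split; last by apply: pinvK; rewrite inE.
apply: (@surjpinv_image_sub _ _ (fun=> 0) (spNc d j) _ (opS d j) (fun _ => id)).
by exists r.
Qed.

Lemma opS_inj (K : fieldType) (B Bb : lmodType K)
    (L : nat -> {linear B -> Bb}) (d : stages B Bb) (j : nat) (u v : B) :
  is_recursion L d -> (1 <= j)%N -> linear (opS d j) ->
  spNc d j u -> spNc d j v -> opS d j u = opS d j v -> u = v.
Proof.
move=> dr j1 lS uN vN Suv; have ds := spN_split dr j1.
have [sNc sN _ _] := ds.
have uvN : spNc d j (u - v) by apply: subspaceD => //; apply: subspaceN.
have uvK : spN d j (u - v).
  rewrite (spNE dr j1); split; first exact: direct_sum_subl ds uvN.
  by rewrite linear_propB // Suv subrr.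
have [uv0 _] := direct_sum_eq0 ds uvN (subspaceN sN uvK) (subrr _).
by apply/eqP; rewrite -subr_eq0 uv0.
Qed.

Lemma Sinv_proj_linear (K : fieldType) (B Bb : lmodType K)
    (L : nat -> {linear B -> Bb}) (d : stages B Bb) (j : nat) :
  is_recursion L d -> (1 <= j)%N -> linear (opS d j) ->
  linear (Sinv d j \o proj d j).
Proof.
move=> dr j1 lS a u v /=.
have [uN uS] := Sinv_image dr j1 lS (proj_in u dr j1).
have [vN vS] := Sinv_image dr j1 lS (proj_in v dr j1).
have [wN wS] := Sinv_image dr j1 lS (proj_in (a *: u + v) dr j1).
apply: (opS_inj dr j1 lS wN).
  by have [[_ NL] _ _ _] := spN_split dr j1; apply: NL.
by rewrite wS lS uS vS (proj_linear dr).
Qed.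

Lemma stage_linear (K : fieldType) (B Bb : lmodType K)
    (L : nat -> {linear B -> Bb}) (d : stages B Bb) (j : nat) :
  is_recursion L d -> (1 <= j)%N ->
  [/\ linear (opSbar d j), linear (opS d j)
    & forall i, (1 <= i <= j)%N -> linear (opM d i j)].
Proof.
move=> dr; elim/ltn_ind: j => j IH j1.
have lSb : linear (opSbar d j).
  case: (ltngtP j 1%N) => [|j2|->].
  - by rewrite ltnNge j1.
  - rewrite (opSbarE dr j2); apply: linear_sum_prop => i ij.
    apply: linear_comp_prop; first exact: linearP.
    have [| |_ _] := IH j.-1; [by rewrite prednK|by rewrite -ltnS prednK|].
    by move=> lM; apply: lM; have /andP[-> ij1] := ij; rewrite /= -ltnS prednK.
  - by rewrite (opSbar1 dr); apply: linearP.
have lS : linear (opS d j).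
  case: (ltngtP j 1%N) => [|j2|->].
  - by rewrite ltnNge j1.
  - rewrite (opSE dr j2); apply: linear_comp_prop => //.
    exact: id_sub_proj_linear dr.
  - by rewrite (opS1 dr); apply: linearP.
have lSv v : (1 <= v <= j)%N -> linear (opSbar d v) /\ linear (opS d v).
  move=> /andP[v1]; rewrite leq_eqVlt => /orP[/eqP->//|vj].
  by have [] := IH v vj v1.
have lE i : (1 <= i <= j)%N -> linear (opE d i j).
  have [m] := ubnP (j - i); elim: m i => // m IHm i jim /andP[i1].
  rewrite leq_eqVlt => /orP[/eqP->|ij].
    case: (ltngtP j 1%N) => [|j2|->]; first by rewrite ltnNge j1.
      by rewrite (opEjj dr j2).
    by rewrite (opE11 dr).
  rewrite (opEij dr) ?i1 //; apply: linear_opp_prop.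
  apply: linear_comp_prop.
    by apply: (Sinv_proj_linear dr i1); have [|//] := lSv i; rewrite i1 ltnW.
  apply: linear_sum_prop => v /andP[iv vj].
  have v1 : (1 <= v)%N by apply: leq_trans iv.
  rewrite ltnS in vj.
  apply: linear_comp_prop; first by have [|//] := lSv v; rewrite v1.
  apply: IHm; last by rewrite v1.
  by apply: leq_trans (ltn_sub2l ij iv) _; rewrite -ltnS.
split => // i /andP[i1 ij].
case: (ltngtP j 1%N) => [|j2|jE]; first by rewrite ltnNge j1.
- case: (ltngtP i 1%N) => [|i2|->]; first by rewrite ltnNge i1.
    rewrite (opMij dr) ?i2 //; apply: linear_sum_prop => v /andP[iv vj].
    rewrite ltnS in vj.
    have v2 : (2 <= v)%N by apply: leq_trans iv.
    apply: linear_comp_prop; last by apply: lE; rewrite vj (ltnW v2).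
    have [| |_ _] := IH v.-1.
    + by rewrite prednK // (ltnW v2).
    + by rewrite -ltnS prednK // (ltnW v2).
    + by move=> lM; apply: lM; rewrite -ltnS prednK // i2 -!subn1 leq_sub2r.
  by rewrite (opM1j dr j2); apply: lE; rewrite j1.
- have -> : i = 1%N by apply/eqP; rewrite eqn_leq i1 -jE ij.
  by rewrite jE (opM11 dr).
Qed.

Lemma opS_Sinv_proj (K : fieldType) (B Bb : lmodType K)
    (L : nat -> {linear B -> Bb}) (d : stages B Bb) (j : nat) (y : Bb) :
  is_recursion L d -> (1 <= j)%N ->
  opS d j (Sinv d j (proj d j y)) = proj d j y.
Proof.
move=> dr j1; have [_ lS _] := stage_linear dr j1.
by have [] := Sinv_image dr j1 lS (proj_in y dr j1).
Qed.

Lemma big_comp_recr (T : Type) (m n : nat) (F : nat -> T -> T) :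
  (m <= n)%N ->
  \big[(fun f g : T -> T => f \o g)/id]_(m <= l < n.+1) F l
  = (\big[(fun f g : T -> T => f \o g)/id]_(m <= l < n) F l) \o F n.
Proof.
move=> mn; rewrite -(subnKC mn); move: (n - m)%N => p {n mn}.
elim: p m => [|p IH] m.
  by rewrite addn0 big_ltn // !big_geq.
rewrite big_ltn; last by rewrite ltnS leq_addr.
rewrite [in RHS]big_ltn; last by rewrite addnS ltnS leq_addr.
by rewrite -addSnnS IH.
Qed.

Lemma comp_id_sub_opB (K : fieldType) (B Bb : lmodType K)
    (L : nat -> {linear B -> Bb}) (d : stages B Bb) (k : nat) :
  is_recursion L d ->
  \big[(fun f g : Bb -> Bb => f \o g)/id]_(1 <= l < k.+1) (id - opB d l)
  = id - \sum_(1 <= i < k.+1) proj d i.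
Proof.
move=> dr; elim: k => [|k IH]; first by rewrite !big_nil subr0.
rewrite big_comp_recr // IH; apply/funext => y.
have Sk z :
    opS d k.+1 z = (id - \sum_(1 <= i < k.+1) proj d i) (opSbar d k.+1 z).
  case: k {IH} => [|k]; last by rewrite (opSE dr).
  by rewrite big_nil subr0 (opS1 dr) (opSbar1 dr).
have lQ := id_sub_proj_linear k.+1 dr.
rewrite /= [(id - opB d k.+1) y]/(y - opB d k.+1 y) (linear_propB _ _ lQ).
rewrite -Sk (opS_Sinv_proj _ dr) // [in RHS]big_nat_recr //=.
by rewrite opprD addrA.
Qed.

Theorem lemma3 (R : realType) (g : ground) (B Bb : lmodType (scalars R g))
    (L : nat -> {linear B -> Bb}) (L_neq0 : exists i x, L i x <> 0)
    (d : stages B Bb) (d_rec : is_recursion L d) (k : nat) (k_ge1 : (1 <= k)%N) :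
  \sum_(1 <= i < k.+1) (opSbar d i \o ope d i k)
  = - \sum_(1 <= i < k.+1) proj d i.
Proof.
pose Q i : Bb -> Bb :=
  \big[(fun f g : Bb -> Bb => f \o g)/id]_(i <= l < k.+1) (id - opB d l).
apply: (@etrans _ _ (\sum_(1 <= i < k.+1) - (Q i.+1 - Q i))).
  apply: eq_big_nat => i /andP[i1 ik]; apply/funext => y.
  have [lSb _ _] := stage_linear d_rec i1.
  rewrite /= linear_propN // [in RHS]/Q [in X in _ - X]big_ltn //.
  by rewrite opprB /= addrAC subrr add0r.
rewrite sumrN telescope_sumr // {1}/Q big_geq // /Q (comp_id_sub_opB _ d_rec).
by rewrite opprD opprK addrC addrAC subrr add0r.
Qed.
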